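(* Let the sequence $(p_n)_{n=1}^\infty$ of numbers in $[0,1]$ satisfy $p_n=\omega(n^{-1}\log n)$ and $p_n=o(n^{-1/2})$ as $n\to\infty$. Then the unlabeled $G(n,p_n)$ graph is asymptotically almost surely non-reconstructable from its $1$-neighborhoods; that is, the probability that the unlabeled $G(n,p_n)$ graph is non-reconstructable from its $1$-neighborhoods tends to $1$ as $n\to\infty$.
   Context: $[n]=\{1,\dots,n\}$. Graphs are simple and undirected. $\omega(g)$ denotes a non-negative quantity with $\omega(g)/g\to\infty$ as $n\to\infty$. An unlabeled graph on $n$ vertices is an equivalence class, with respect to graph isomorphism, of graphs with vertex set $[n]$. The $G(n,p)$ graph on $[n]$ is the random graph in which each pair of distinct vertices is joined by an edge with probability $p$ independently of other pairs; the unlabeled $G(n,p)$ graph is the random isomorphism class of the labeled $G(n,p)$ graph. For a labeled graph $G'$ on $[n]$ and a vertex $v$, the $1$-neighborhood of $v$ is the subgraph of $G'$ induced by the set of vertices at distance at most $1$ from $v$. For an unlabeled graph $G$ on $n$ vertices with a labeled representative $G'$, the $n$-multiset of $1$-neighborhoods of $G$ is the multiset of the graph isomorphism classes of the $1$-neighborhoods of $v=1,2,\dots,n$ in $G'$ (this does not depend on the representative). An unlabeled graph $G$ on $n$ vertices is reconstructable from its $1$-neighborhoods if, whenever $\tilde G$ is an unlabeled graph on $n$ vertices such that the $n$-multisets of $1$-neighborhoods of $G$ and $\tilde G$ coincide, necessarily $G=\tilde G$. Otherwise $G$ is non-reconstructable from its $1$-neighborhoods. *)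

(* Defs.v *)
From HB Require Import structures.
From mathcomp Require Import all_boot all_order all_algebra.
From mathcomp Require Import finmap multiset.
From mathcomp Require Import all_classical all_reals all_analysis.

Set Implicit Arguments.
Unset Strict Implicit.
Unset Printing Implicit Defensive.
Import Order.TTheory GRing.Theory Num.Theory.
Import numFieldNormedType.Exports.
Local Open Scope classical_set_scope.
Local Open Scope ring_scope.
Local Open Scope quotient_scope.

Record sgraph (T : finType) := SGraph {
  edges :> {set {set T}};
  _ : [forall e in edges, #|e| == 2%N] }.

HB.instance Definition _ (T : finType) := [isSub for @edges T].
HB.instance Definition _ (T : finType) := [Finite of sgraph T by <:].

Definition adj (T : finType) (G : sgraph T) : rel T :=
  fun x y => [set x; y]%SET \in edges G.

Lemma edge_card (T : finType) (G : sgraph T) e : e \in edges G -> #|e| = 2%N.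
Proof. by case: G => E /= /'forall_implyP h /h /eqP. Qed.

Lemma adj_sym (T : finType) (G : sgraph T) : symmetric (adj G).
Proof. by move=> x y; rewrite /adj finset.setUC. Qed.

Lemma adj_irr (T : finType) (G : sgraph T) : irreflexive (adj G).
Proof.
by move=> x; apply/negP => /edge_card; rewrite finset.setUid cards1.
Qed.

Lemma adj_inj (T : finType) (G H : sgraph T) : adj G =2 adj H -> G = H.
Proof.
move=> GH; apply/val_inj/setP => e.
have [/cards2P[x] [y] [_ ->]|ne] := boolP (#|e| == 2%N); first exact: GH.
by apply/idP/idP => /edge_card/eqP; rewrite (negPf ne).
Qed.

(** The graph on [T1] in which [x] and [y] are adjacent iff their images under
    [f : T1 -> T2] are (see [adj_pullback]); used below for injective [f]. *)
Definition pullback_edges (T1 T2 : finType) (f : T1 -> T2) (G : sgraph T2) :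
    {set {set T1}} :=
  [set e : {set T1} | (#|e| == 2%N) && ((f @: e)%SET \in edges G)]%SET.

Lemma pullback_subproof (T1 T2 : finType) (f : T1 -> T2) (G : sgraph T2) :
  [forall e in pullback_edges f G, #|e| == 2%N].
Proof. by apply/'forall_implyP => e; rewrite inE => /andP[]. Qed.

Definition pullback (T1 T2 : finType) (f : T1 -> T2) (G : sgraph T2) :
  sgraph T1 := SGraph (pullback_subproof f G).

Lemma adj_pullback (T1 T2 : finType) (f : T1 -> T2) (G : sgraph T2) x y :
  adj (pullback f G) x y = adj G (f x) (f y).
Proof.
rewrite /adj /= inE imsetU1 imset_set1 cards2.
by have [->|//] := eqVneq x y; rewrite [RHS]adj_irr.
Qed.

Definition induced (T : finType) (G : sgraph T) (S : {set T}) :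
    sgraph {x : T | x \in S} :=
  pullback val G.

Definition giso (T1 T2 : finType) (G : sgraph T1) (H : sgraph T2) : bool :=
  `[< exists2 f : T1 -> T2, bijective f &
      forall x y, adj H (f x) (f y) = adj G x y >].

Lemma giso_refl (T : finType) (G : sgraph T) : giso G G.
Proof. by apply/asboolP; exists id => //; exists id. Qed.

Lemma giso_sym (T1 T2 : finType) (G : sgraph T1) (H : sgraph T2) :
  giso G H -> giso H G.
Proof.
move=> /asboolP[f [g fK gK] fP]; apply/asboolP; exists g; first by exists f.
by move=> x y; rewrite -fP !gK.
Qed.

Lemma giso_trans (T1 T2 T3 : finType)
    (G : sgraph T1) (H : sgraph T2) (K : sgraph T3) :
  giso G H -> giso H K -> giso G K.
Proof.
move=> /asboolP[f bf fP] /asboolP[g bg gP]; apply/asboolP.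
by exists (g \o f); [exact: bij_comp | move=> x y /=; rewrite gP fP].
Qed.

Definition ord_giso (n : nat) : rel (sgraph 'I_n) := fun G H => giso G H.

Lemma ord_giso_equiv (n : nat) : equiv_class_of (@ord_giso n).
Proof.
split=> [G|G H|G H K]; first exact: giso_refl.
- by apply/idP/idP; exact: giso_sym.
- exact: giso_trans.
Qed.

Canonical ord_giso_equivRel (n : nat) := EquivRelPack (@ord_giso_equiv n).

Definition ugraph (n : nat) := {eq_quot (@ord_giso n)}.

HB.instance Definition _ (n : nat) := EqQuotient.on (ugraph n).
HB.instance Definition _ (n : nat) :=
  Finite.copy (ugraph n)
    (can_type (EquivQuot.ereprK (encD := defaultEncModRel (@ord_giso n)))).

Definition ugraphs := {k : nat & ugraph k}.

(** The isomorphism class of a graph on an arbitrary finite vertex set; [T] is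
    identified with ['I_#|T|] through its enumeration. *)
Definition iso_class (T : finType) (G : sgraph T) : ugraphs :=
  Tagged ugraph (\pi_(ugraph #|T|) (pullback enum_val G)).

Lemma pullback_enum_giso (T : finType) (G : sgraph T) :
  giso (pullback (@enum_val T predT) G) G.
Proof.
apply/asboolP; exists enum_val; first exact: enum_val_bij.
by move=> x y; rewrite adj_pullback.
Qed.

Lemma iso_classP (T1 T2 : finType) (G : sgraph T1) (H : sgraph T2) :
  iso_class G = iso_class H <-> giso G H.
Proof.
have Gp := pullback_enum_giso G; have Hp := pullback_enum_giso H.
rewrite /iso_class; split.
  move: (pullback _ G) (pullback _ H) Gp Hp => G' H' Gp Hp.
  move: G' H' Gp Hp; move: #|T1| #|T2| => k1 k2 G' H' Gp Hp E.
  have k12 : k1 = k2 := congr1 tag E.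
  subst k2; move/eqP: E; rewrite eq_Tagged /= => /eqP/eqmodP GH.
  apply: giso_trans (giso_sym Gp) _; exact: giso_trans GH Hp.
move=> GH; have c12 : #|T1| = #|T2|.
  by have /asboolP[f bf _] := GH; exact: bij_eq_card bf.
move: (pullback _ G) (pullback _ H) Gp Hp => G' H' Gp Hp.
have : giso G' H' by exact: giso_trans Gp (giso_trans GH (giso_sym Hp)).
move: G' H' {Gp Hp GH}; rewrite c12 => G' H' GH.
by congr Tagged; apply/eqmodP.
Qed.

(** The vertices at distance at most [r] from [v], i.e. the endpoints of the
    walks of length at most [r] starting from [v]. *)
Definition gball (T : finType) (G : sgraph T) (r : nat) (v : T) : {set T} :=
  [set u | [exists k : 'I_r.+1, [exists s : k.-tuple T,
     path (adj G) v s && (last v s == u)]]]%SET.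

Lemma gball1E (T : finType) (G : sgraph T) (v u : T) :
  (u \in gball G 1 v) = (u == v) || adj G v u.
Proof.
rewrite inE; apply/existsP/orP => [[[k /= kr] /existsP[s /andP[]]]|].
  case: k kr s => [|[|//]] kr [[|a [|b s]] //= _].
    by move=> _ /eqP ->; left.
  by rewrite andbT => va /eqP <-; right.
case=> [/eqP ->|vu].
  by exists ord0; apply/existsP; exists [tuple]; rewrite /= eqxx.
by exists ord_max; apply/existsP; exists [tuple u]; rewrite /= vu eqxx.
Qed.

Definition nbhd1 (T : finType) (G : sgraph T) (v : T) :
    sgraph {x : T | x \in gball G 1 v} :=
  induced G (gball G 1 v).

Definition nbhds (n : nat) (G : sgraph 'I_n) : {mset ugraphs}%mset :=
  seq_mset [seq iso_class (nbhd1 G v) | v <- enum 'I_n].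

(** Does not depend on the representative, see [unbhds_pi]. *)
Definition unbhds (n : nat) (U : ugraph n) : {mset ugraphs}%mset := nbhds (repr U).

Lemma nbhds_giso (n : nat) (G H : sgraph 'I_n) : giso G H -> nbhds G = nbhds H.
Proof.
move=> /asboolP[f bf fP]; apply/eq_seq_msetP.
have fi : injective f := bij_inj bf.
have -> : [seq iso_class (nbhd1 G v) | v <- enum 'I_n] =
          [seq iso_class (nbhd1 H v) | v <- map f (enum 'I_n)].
  rewrite -map_comp; apply: eq_map => v /=; apply/iso_classP.
  have fB x : (f x \in gball H 1 (f v)) = (x \in gball G 1 v).
    by rewrite !gball1E fP (inj_eq fi).
  have [g fK gK] := bf.
  have gB y : y \in gball H 1 (f v) -> g y \in gball G 1 v.
    by rewrite -fB gK.
  have fB' x : x \in gball G 1 v -> f x \in gball H 1 (f v) by rewrite fB.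
  apply/asboolP; exists (fun x => exist _ (f (val x)) (fB' _ (valP x))).
    exists (fun y => exist _ (g (val y)) (gB _ (valP y))) => x.
      by apply: val_inj; rewrite /= fK.
    by apply: val_inj; rewrite /= gK.
  by move=> x y; rewrite !adj_pullback /= fP.
apply: perm_map; apply: uniq_perm.
- by rewrite (map_inj_uniq fi) enum_uniq.
- exact: enum_uniq.
have [g _ gK] := bf => x.
by rewrite -(gK x) (mem_map fi) !mem_enum.
Qed.

Lemma unbhds_pi (n : nat) (G : sgraph 'I_n) :
  unbhds (\pi_(ugraph n) G) = nbhds G.
Proof.
apply: nbhds_giso; rewrite -/(ord_giso (repr _) G).
by apply/eqmodP; rewrite reprK.
Qed.

Definition reconstructable (n : nat) (U : ugraph n) : bool :=
  [forall V : ugraph n, (unbhds U == unbhds V) ==> (U == V)].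

(** The probability that the labeled [G(n,p)] graph equals [G]. *)
Definition gnp (R : realType) (n : nat) (p : R) (G : sgraph 'I_n) : R :=
  \prod_(e : {set 'I_n} | #|e| == 2%N) (if e \in edges G then p else 1 - p).

(** The law of the isomorphism class of the labeled [G(n,p)] graph. *)
Definition ugnp (R : realType) (n : nat) (p : R) (U : ugraph n) : R :=
  \sum_(G : sgraph 'I_n | \pi_(ugraph n) G == U) gnp p G.

Definition ugnp_prob (R : realType) (n : nat) (p : R) (A : pred (ugraph n)) : R :=
  \sum_(U : ugraph n | A U) ugnp p U.

Lemma gnp_ge0 (R : realType) (n : nat) (p : R) (G : sgraph 'I_n) :
  0 <= p <= 1 -> 0 <= gnp p G.
Proof.
move=> /andP[p0 p1]; apply: prodr_ge0 => e _.
by case: ifP => // _; rewrite subr_ge0.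
Qed.

Lemma sum_gnp (R : realType) (n : nat) (p : R) :
  \sum_(G : sgraph 'I_n) gnp p G = 1.
Proof.
pose P := [set e : {set 'I_n} | #|e| == 2%N]%SET.
transitivity (\prod_(e : {set 'I_n})
    ((if e \in P then p else 0) + (if e \in P then 1 - p else 1))).
  rewrite bigA_distr (bigID (fun E : {set {set 'I_n}} => E \subset P)) /=.
  rewrite [X in _ = _ + X]big1 ?addr0; last first.
    move=> E /fintype.subsetPn[e eE eP]; apply/eqP/prodf_eq0; exists e => //.
    by rewrite eE (negPf eP).
  have EP (G : sgraph 'I_n) : edges G \subset P.
    by apply/fintype.subsetP => e /edge_card eG; rewrite inE eG.
  have PE (E : {set {set 'I_n}}) : E \subset P -> [forall e in E, #|e| == 2%N].
    by move=> /fintype.subsetP EP'; apply/'forall_implyP => e /EP'; rewrite inE.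
  rewrite (reindex_onto (@edges 'I_n) (insubd (SGraph (PE _ (finset.sub0set P))))) /=.
    apply: eq_big => [G|G _]; first by rewrite EP /= valKd eqxx.
    rewrite /gnp big_mkcond /=; apply: eq_bigr => e _.
    rewrite inE; case: ifP => // /negbT e2; case: ifPn => // /edge_card/eqP.
    by rewrite (negPf e2).
  by move=> E /PE EP'; exact: (@insubdK _ _ (sgraph 'I_n) _ _ EP').
by apply: big1 => e _; case: ifP => _; rewrite ?add0r // addrC subrK.
Qed.

Lemma sum_ugnp (R : realType) (n : nat) (p : R) :
  \sum_(U : ugraph n) ugnp p U = 1.
Proof.
rewrite -(sum_gnp n p) (partition_big (fun G => \pi_(ugraph n) G) predT) //=.
Qed.

(** [f] is eventually nonnegative and [f / g] tends to infinity; meant for [g]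
    eventually positive. *)
Definition little_omega (R : realType) (f g : R^nat) : Prop :=
  (\forall n \near \oo, 0 <= f n) /\ f n / g n @[n --> \oo] --> +oo.

(* Main.v *)
(** An entropy argument. Let [T] be the number of (ordered) triangles. A
    neighborhood is a cone over the graph induced by the neighbors of its apex, so
    the multiset of neighborhoods of a graph is determined by [O(n + T)] numbers
    of size at most [n]: the degrees and the triangles. Hence there are
    [n ^ O(n + t)] labeled reconstructable graphs with [T <= t]. Since [n p^2 -> 0],
    Markov's inequality gives [T = o(n^2 p)] with high probability, while there are
    at least a constant times [n^2 p] edges by Chernoff's bound, so that each such
    graph has probability at most [p ^ (c n^2 p) <= n ^ (- c n^2 p / 2)]. As
    [n p -> oo], this beats the number of graphs. *)

Require Import Defs.
From mathcomp Require Import all_boot all_order all_algebra.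
From mathcomp Require Import all_classical all_reals all_analysis.
From mathcomp Require Import ring lra zify.
Import Order.TTheory GRing.Theory Num.Theory.
Import numFieldNormedType.Exports.
Set Implicit Arguments.
Unset Strict Implicit.
Local Open Scope ring_scope.
Local Open Scope quotient_scope.

(** * Coding neighborhoods by ranks within balls *)

Definition triangles (T : finType) (G : sgraph T) : {set T * T * T} :=
  [set z | [&& adj G z.1.1 z.1.2, adj G z.1.1 z.2 & adj G z.1.2 z.2]]%SET.

(** Ranks make the balls of different graphs comparable. Outside the ball the index is the size of
    the ball, which may be [n]; hence ['I_n.+1]. *)
Definition brank (n : nat) (G : sgraph 'I_n) (v x : 'I_n) : 'I_n.+1 :=
  inord (index x (enum (gball G 1 v))).

Lemma brank_val (n : nat) (G : sgraph 'I_n) (v x : 'I_n) :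
  brank G v x = index x (enum (gball G 1 v)) :> nat.
Proof.
rewrite inordK // ltnS (leq_trans (index_size _ _)) // -cardE.
by rewrite (leq_trans (max_card _)) ?card_ord.
Qed.

Lemma brank_inj (n : nat) (G : sgraph 'I_n) (v : 'I_n) :
  {in gball G 1 v &, injective (brank G v)}.
Proof.
rewrite -[gball G 1 v]set_enum => x y; rewrite !inE => xB yB.
move=> /(congr1 (@nat_of_ord _)); rewrite !brank_val; exact: index_inj.
Qed.

(** The neighborhood of [v] is a cone with apex [v] over the graph induced by the
    neighbors of [v], so up to isomorphism it is given by its size, the rank of
    its apex and the ranks of the edges opposite to [v] in a triangle. *)
Definition nbhd_code (n : nat) (G : sgraph 'I_n) :
    {ffun 'I_n -> 'I_n.+1 * 'I_n.+1} * {set 'I_n * 'I_n.+1 * 'I_n.+1} :=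
  ([ffun v => (inord #|gball G 1 v|, brank G v v)],
   [set (z.1.1, brank G z.1.1 z.1.2, brank G z.1.1 z.2) | z in triangles G]%SET).

(** The apex is adjacent to every other vertex of its ball, and two further vertices are adjacent
    iff they form a triangle with it. By [brank_inj], ranks identify vertices of the ball. *)
Lemma adj_nbhd_code (n : nat) (G : sgraph 'I_n) (v x y : 'I_n) :
  x \in gball G 1 v -> y \in gball G 1 v ->
  adj G x y = (x != y) && [|| brank G v x == ((nbhd_code G).1 v).2,
    brank G v y == ((nbhd_code G).1 v).2 |
    (v, brank G v x, brank G v y) \in (nbhd_code G).2].
Proof.
move=> xB yB; rewrite ffunE /=.
have vB : v \in gball G 1 v by rewrite gball1E eqxx.
have brv z : z \in gball G 1 v -> (brank G v z == brank G v v) = (z == v).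
  by move=> zB; apply/eqP/eqP => [|->//]; exact: brank_inj.
rewrite !brv //; have [->|xy] /= := eqVneq x y; first exact: adj_irr.
move: (xB) (yB); rewrite !gball1E => xB' yB'.
have [xv|xv] /= := eqVneq x v.
  by move: yB'; rewrite -xv eq_sym (negPf xy).
have [yv|yv] /= := eqVneq y v.
  by move: xB'; rewrite -yv (negPf xy) adj_sym.
move: xB' yB'; rewrite (negPf xv) (negPf yv) /= => vx vy.
apply/idP/imsetP => [axy|[[[w a] b]]].
  by exists (v, x, y); rewrite // inE /= vx vy.
rewrite inE /= => /and3P[wa wb ab] /eqP; rewrite !xpair_eqE.
case/andP=> /andP[/eqP vw]; rewrite -{w}vw in wa wb * => /eqP ra /eqP rb.
have aB : a \in gball G 1 v by rewrite gball1E wa orbT.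
have bB : b \in gball G 1 v by rewrite gball1E wb orbT.
by rewrite (brank_inj xB aB ra) (brank_inj yB bB rb).
Qed.

(** Equal codes give equal ball sizes, so matching vertices of equal rank is a bijection of balls;
    [adj_nbhd_code] makes it an isomorphism. *)
Lemma nbhd_code_nbhds (n : nat) (G H : sgraph 'I_n) :
  nbhd_code G = nbhd_code H -> nbhds G = nbhds H.
Proof.
move=> GH; congr multiset.seq_mset; apply: eq_map => v; apply/iso_classP/asboolP.
have BE : #|gball G 1 v| = #|gball H 1 v|.
  have [/ffunP/(_ v) + _] := GH; rewrite !ffunE => -[/(congr1 (@nat_of_ord _)) + _].
  by rewrite !inordK // ltnS -[leqRHS]card_ord max_card.
pose h (K L : sgraph 'I_n) x := nth v (enum (gball L 1 v)) (index x (enum (gball K 1 v))).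
have hB (K L : sgraph 'I_n) x : #|gball K 1 v| = #|gball L 1 v| ->
    x \in gball K 1 v -> h K L x \in gball L 1 v.
  by move=> KL xK; rewrite -mem_enum mem_nth // -cardE -KL cardE index_mem mem_enum.
have hr (K L : sgraph 'I_n) x : #|gball K 1 v| = #|gball L 1 v| ->
    x \in gball K 1 v -> brank L v (h K L x) = brank K v x.
  move=> KL xK; apply: ord_inj; rewrite !brank_val index_uniq ?enum_uniq //.
  by rewrite -cardE -KL cardE index_mem mem_enum.
have hK (K L : sgraph 'I_n) x : #|gball K 1 v| = #|gball L 1 v| ->
    x \in gball K 1 v -> h L K (h K L x) = x.
  move=> KL xK; apply: (@brank_inj _ K v) => //; first by rewrite !hB.
  by rewrite !hr ?hB.
exists (fun x => exist _ (h G H (val x)) (hB G H _ BE (valP x))).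
  by exists (fun x => exist _ (h H G (val x)) (hB H G _ (esym BE) (valP x))) => x;
    apply: val_inj; rewrite /= hK ?(valP x).
move=> x y; have xB := valP x; have yB := valP y.
rewrite !adj_pullback /= (adj_nbhd_code (v := v)) ?hB //.
rewrite [RHS](adj_nbhd_code xB yB) -GH !hr //; congr (~~ _ && _).
by apply/eqP/eqP => [E|->//]; rewrite -(hK G H _ BE xB) E hK.
Qed.

(** * Counting reconstructable graphs with few triangles *)

(** Such a set is the set of entries of a [t]-tuple over [option T], padded with [None]. *)
Lemma card_small_sets (T : finType) (t : nat) :
  (#|[set S : {set T} | #|S| <= t]%SET| <= #|T|.+1 ^ t)%N.
Proof.
rewrite -card_option -card_tuple -cardsT.
pose f (s : t.-tuple (option T)) := [set x | Some x \in s]%SET.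
apply: leq_trans (leq_imset_card f _); apply: subset_leq_card.
apply/fintype.subsetP => S; rewrite inE => St; apply/imsetP.
have sz : size (map Some (enum S) ++ nseq (t - #|S|) None) == t.
  by rewrite size_cat size_map -cardE size_nseq subnKC.
exists (Tuple sz); first by rewrite inE.
apply/setP => x; rewrite inE /= mem_cat mem_nseq andbF orbF.
by rewrite mem_map ?mem_enum // => a b [].
Qed.

(** A reconstructable graph is determined by its code and by a map relabeling
    the chosen representative of its isomorphism class. *)
Lemma card_reconstructable (n t : nat) :
  (#|[set G : sgraph 'I_n | reconstructable (\pi_(ugraph n) G) &
      #|triangles G| <= t]%SET| <= n.+1 ^ (3 * (n + t)))%N.
Proof.
pose rel G := [pick f : {ffun 'I_n -> 'I_n} | G == pullback f (repr (\pi_(ugraph n) G))].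
have relE G : exists2 f, rel G = Some f & G = pullback f (repr (\pi_(ugraph n) G)).
  rewrite /rel; case: pickP => [f /eqP Gf|]; first by exists f.
  have /eqmodP/asboolP[f _ fP] : \pi_(ugraph n) G = \pi_(ugraph n) (repr (\pi_(ugraph n) G)).
    by rewrite reprK.
  move=> /(_ (finfun f))/eqP[]; apply: adj_inj => x y.
  by rewrite adj_pullback !ffunE fP.
set A := [set G | _]%SET.
(* By [relE], the default identity map is never taken. *)
pose code G := (nbhd_code G, odflt [ffun x => x] (rel G)).
pose S := [set S : {set 'I_n * 'I_n.+1 * 'I_n.+1} | (#|S| <= t)%N]%SET.
have codeA : {in A &, injective code}.
  move=> G H; rewrite !inE => /andP[/forallP rG _] _ [c1 c2 Ef].
  have : \pi_(ugraph n) G = \pi_(ugraph n) H.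
    apply/eqP; apply: (implyP (rG _)); rewrite !unbhds_pi; apply/eqP.
    by apply: nbhd_code_nbhds; rewrite /nbhd_code c1 c2.
  have [f rf fG] := relE G; have [g rg gH] := relE H.
  by move: Ef; rewrite rf rg /= => fg GH; rewrite fG gH fg GH.
rewrite -(card_in_imset codeA).
apply: (@leq_trans #|finset.setX (finset.setX [set: {ffun 'I_n -> 'I_n.+1 * 'I_n.+1}] S)
   [set: {ffun 'I_n -> 'I_n}]|).
  apply: subset_leq_card; apply/fintype.subsetP => _ /imsetP[G GA ->].
  rewrite !inE /= andbT (leq_trans (leq_imset_card _ _)) //.
  by move: GA; rewrite inE => /andP[].
rewrite !cardsX !cardsT !card_ffun !card_prod !card_ord.
(* The exponent splits into [2 * n] for sizes and apex ranks, [3 * t] for triangles and [n] for the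
   relabeling. *)
apply: (@leq_trans ((n.+1 * n.+1) ^ n * (n.+1 ^ 3) ^ t * n.+1 ^ n)%N).
  apply: leq_mul; last by case: (n) => // m; rewrite leq_exp2r.
  apply: leq_mul => //.
  apply: leq_trans (card_small_sets _ _) _; rewrite !card_prod !card_ord.
  case: t {A S codeA} => // t; rewrite leq_exp2r // !expnS expn0; nia.
by rewrite mulnn -!expnM -!expnD leq_pexp2l //; lia.
Qed.

(** * Edges and triangles of the labeled random graph *)

(** Independence of edges: the expectation of a product over pairs factors. *)
Lemma gnp_expectation (R : realType) (n : nat) (p : R) (a b : {set 'I_n} -> R) :
  \sum_(G : sgraph 'I_n) gnp p G *
     \prod_(e : {set 'I_n} | #|e| == 2%N) (if e \in edges G then a e else b e) =
  \prod_(e : {set 'I_n} | #|e| == 2%N) (p * a e + (1 - p) * b e).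
Proof.
(* Off the pairs the values [0] and [1] kill every family containing a non-pair when the product
   over all sets is expanded. *)
pose u (e : {set 'I_n}) := if #|e| == 2%N then p * a e else 0.
pose w (e : {set 'I_n}) := if #|e| == 2%N then (1 - p) * b e else 1.
transitivity (\prod_(e : {set 'I_n}) (u e + w e)); last first.
  rewrite [RHS]big_mkcond; apply: eq_bigr => e _; rewrite /u /w.
  by case: ifP => // _; rewrite add0r.
rewrite bigA_distr.
rewrite (bigID (fun E : {set {set 'I_n}} => [forall e in E, #|e| == 2%N])) /=.
rewrite [X in _ = _ + X]big1 ?addr0; last first.
  move=> E /forallPn[e]; rewrite negb_imply => /andP[eE /negPf e2].
  by apply/eqP/prodf_eq0; exists e => //; rewrite eE /u e2.
have g0 : [forall e in (finset.set0 : {set {set 'I_n}}), #|e| == 2%N].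
  by apply/'forall_implyP => e; rewrite inE.
rewrite (reindex_onto (@edges 'I_n) (insubd (SGraph g0))) /=; last first.
  by move=> E hE; exact: (@insubdK _ _ (sgraph 'I_n)).
apply: eq_big => [G|G _]; first by rewrite valKd eqxx andbT (valP G).
rewrite /gnp -big_split big_mkcond; apply: eq_bigr => e _ /=; rewrite /u /w.
by case: ifPn => e2; case: ifPn => // /edge_card/eqP; rewrite (negPf e2).
Qed.

(** With [a = 1] and [b] the indicator of the complement of [S], the product in [gnp_expectation] is
    the indicator of the event. *)
Lemma sum_gnp_supset (R : realType) (n : nat) (p : R) (S : {set {set 'I_n}}) :
  (forall e, e \in S -> #|e| = 2%N) ->
  \sum_(G : sgraph 'I_n | S \subset edges G) gnp p G = p ^+ #|S|.
Proof.
move=> S2.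
transitivity (\sum_(G : sgraph 'I_n) gnp p G *
     \prod_(e : {set 'I_n} | #|e| == 2%N)
       (if e \in edges G then 1 else (e \notin S)%:R)).
  rewrite big_mkcond; apply: eq_bigr => G _; case: ifPn => [/fintype.subsetP SG|].
    rewrite big1 ?mulr1 // => e _; case: ifPn => // eG.
    by rewrite (contra (@SG e) eG).
  move=> /fintype.subsetPn[e eS eG]; rewrite (bigD1 e) ?S2 //=.
  by rewrite (negPf eG) eS mul0r mulr0.
rewrite (gnp_expectation p (fun=> 1)) -prodr_const.
rewrite big_mkcond [RHS]big_mkcond; apply: eq_bigr => e _ /=.
case: ifPn => e2; case: ifPn => eS /=.
- by rewrite mulr1 mulr0 addr0.
- by rewrite !mulr1 addrC subrK.
- by move: e2; rewrite S2 // eqxx.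
- by [].
Qed.

(** Linearity of expectation over [n ^ 3] triples: three distinct vertices need three distinct
    edges, and degenerate triples are never triangles. *)
Lemma sum_gnp_triangles (R : realType) (n : nat) (p : R) : 0 <= p <= 1 ->
  \sum_(G : sgraph 'I_n) gnp p G * #|triangles G|%:R <= (n%:R * p) ^+ 3.
Proof.
move=> p01.
have tri z : \sum_(G : sgraph 'I_n | z \in triangles G) gnp p G <= p ^+ 3.
  case: z => -[x y] z; set Z := (_, _, _).
  have [/and3P[xy xz yz]|ne] := boolP [&& x != y, x != z & y != z]; last first.
    rewrite big_pred0 ?exprn_ge0 ?(andP p01).1 // => G.
    apply: contraNF ne; rewrite inE /= => /and3P[xy xz yz].
    by apply/and3P; split; apply/eqP => E; move: xy xz yz;
      rewrite E adj_irr ?andbF.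
  pose S := [set [set x; y]; [set x; z]; [set y; z]]%SET.
  have S3 : #|S| = 3%N.
    have xyxz : [set x; y]%SET != [set x; z]%SET.
      by apply/eqP => /setP/(_ y); rewrite !inE eqxx orbT eq_sym (negPf xy) (negPf yz).
    have xyyz : [set x; y]%SET != [set y; z]%SET.
      by apply/eqP => /setP/(_ x); rewrite !inE eqxx (negPf xy) (negPf xz).
    have xzyz : [set x; z]%SET != [set y; z]%SET.
      by apply/eqP => /setP/(_ x); rewrite !inE eqxx (negPf xy) (negPf xz).
    rewrite /S finset.setUC cardsU1 !inE negb_or ![_ == [set x; _]%SET]eq_sym.
    by rewrite xyyz xzyz cards2 xyxz.
  rewrite -S3 -sum_gnp_supset.
    rewrite le_eqVlt; apply/orP; left; apply/eqP; apply: eq_bigl => G.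
    rewrite inE /= /adj; apply/and3P/fintype.subsetP => [[A B C] e|H].
      by rewrite !inE => /orP[/orP[]|] /eqP ->.
    by split; apply: H; rewrite !inE eqxx ?orbT.
  by move=> e; rewrite !inE => /orP[/orP[]|] /eqP ->; rewrite cards2 ?xy ?xz ?yz.
under eq_bigr do rewrite -sum1_card natr_sum mulr_sumr big_mkcond.
rewrite exchange_big /=.
apply: (@le_trans _ _ (\sum_(z : 'I_n * 'I_n * 'I_n) p ^+ 3)).
  apply: ler_sum => z _; rewrite -big_mkcond /=.
  by under eq_bigr do rewrite mulr1; exact: tri.
rewrite sumr_const !card_prod card_ord; rewrite -[leLHS]mulr_natl exprMn !natrM.
by rewrite !exprS !expr0 !mulr1 !mulrA.
Qed.

(** Markov's inequality. *)
Lemma prob_many_triangles (R : realType) (n : nat) (p : R) (t : nat) :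
  0 <= p <= 1 ->
  \sum_(G : sgraph 'I_n | (t < #|triangles G|)%N) gnp p G <=
  (n%:R * p) ^+ 3 / t.+1%:R.
Proof.
move=> p01; rewrite ler_pdivlMr ?ltr0n //; apply: le_trans (sum_gnp_triangles n p01).
rewrite mulr_suml big_mkcond; apply: ler_sum => G _.
have g0 := gnp_ge0 G p01.
by case: ifPn => // tG; [rewrite ler_wpM2l ?ler_nat | rewrite mulr_ge0].
Qed.

(** Chernoff's method applied to the expectation of [2 ^- #|edges G|]. *)
Lemma prob_few_edges (R : realType) (n : nat) (p : R) (k : nat) : 0 <= p <= 1 ->
  \sum_(G : sgraph 'I_n | (#|edges G| < k)%N) gnp p G <=
  expR (k%:R - 'C(n, 2)%:R * p / 2).
Proof.
move=> p01; have /andP[p0 p1] := p01.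
apply: (@le_trans _ _ (2 ^+ k * \sum_(G : sgraph 'I_n) gnp p G *
     \prod_(e : {set 'I_n} | #|e| == 2%N) (if e \in edges G then 2^-1 else 1))).
  rewrite mulr_sumr big_mkcond; apply: ler_sum => G _.
  have g0 := gnp_ge0 G p01.
  have -> : \prod_(e : {set 'I_n} | #|e| == 2%N)
      (if e \in edges G then 2^-1 else 1) = 2 ^- #|edges G| :> R.
    rewrite -big_mkcondr /= -exprVn -prodr_const; apply: eq_bigl => e.
    by rewrite andb_idl // => /edge_card ->.
  case: ifPn => [Gk|_]; last by rewrite !mulr_ge0 ?exprn_ge0 ?invr_ge0.
  by rewrite mulrCA ler_peMr // ler_pdivlMr ?exprn_gt0 // mul1r ler_eXn2l ?ltr1n // ltnW.
rewrite (gnp_expectation p (fun=> 2^-1) (fun=> 1)).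
rewrite (eq_bigl (fun e => e \in [set e : {set 'I_n} | #|e| == 2%N]%SET)); last first.
  by move=> e; rewrite inE.
rewrite prodr_const card_draws card_ord expRD; apply: ler_pM.
- exact: exprn_ge0.
- by rewrite exprn_ge0 // addr_ge0 ?mulr_ge0 ?subr_ge0.
(* [2 <= e]. *)
- rewrite -[k%:R]mulr1 expRM_natl; apply: lerXn2r; rewrite ?nnegrE ?expR_ge0 //.
  by have := @expR_ge1Dx R 1; rewrite -[1 + 1]/(2%:R).
(* Each pair contributes [p / 2 + (1 - p) = 1 - p / 2 <= expR (- (p / 2))]. *)
- rewrite -mulrA -mulrN expRM_natl; apply: lerXn2r.
  + by rewrite nnegrE addr_ge0 ?mulr_ge0 ?subr_ge0.
  + by rewrite nnegrE expR_ge0.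
  have := @expR_ge1Dx R (- (p / 2)); apply: le_trans.
  by rewrite le_eqVlt; apply/orP; left; apply/eqP; lra.
Qed.

Lemma gnp_le (R : realType) (n : nat) (p : R) (G : sgraph 'I_n) (k : nat) :
  0 <= p <= 1 -> (k <= #|edges G|)%N -> gnp p G <= p ^+ k.
Proof.
move=> /andP[p0 p1] kG.
apply: (@le_trans _ _ (p ^+ #|edges G|)); last exact: ler_wiXn2l.
rewrite -prodr_const big_mkcond /= /gnp big_mkcond; apply: ler_prod => e _.
case: ifPn => [_|e2].
  by case: ifP => _; rewrite ?p0 ?lexx // subr_ge0 p1 lerBlDr lerDl p0.
by case: ifPn => [/edge_card/eqP|]; rewrite ?(negPf e2) // ler01 lexx.
Qed.

(** * Bounding the probability of reconstructability for fixed [n] *)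

Lemma ugnp_probE (R : realType) (n : nat) (p : R) (A : pred (ugraph n)) :
  ugnp_prob p A = \sum_(G : sgraph 'I_n | A (\pi_(ugraph n) G)) gnp p G.
Proof.
rewrite (partition_big (fun G => \pi_(ugraph n) G) A) //=.
apply: eq_bigr => U AU; apply: eq_bigl => G.
by apply/idP/andP => [/eqP ->|[]].
Qed.

Lemma ugnp_probC (R : realType) (n : nat) (p : R) (A : pred (ugraph n)) :
  ugnp_prob p (fun U => ~~ A U) = 1 - ugnp_prob p A.
Proof. by rewrite -(sum_ugnp n p) (bigID A) /= addrAC subrr add0r. Qed.

Lemma ugnp_prob_ge0 (R : realType) (n : nat) (p : R) (A : pred (ugraph n)) :
  0 <= p <= 1 -> 0 <= ugnp_prob p A.
Proof. by move=> p01; rewrite ugnp_probE sumr_ge0 // => G _; exact: gnp_ge0. Qed.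

(** Union bound: few edges, many triangles, or one of the graphs counted by [card_reconstructable],
    each of probability at most [p ^+ k]. *)
Lemma prob_reconstructable_le (R : realType) (n : nat) (p : R) (k t : nat) :
  0 <= p <= 1 ->
  ugnp_prob p (@reconstructable n) <=
  expR (k%:R - 'C(n, 2)%:R * p / 2) + (n%:R * p) ^+ 3 / t.+1%:R +
  (n.+1 ^ (3 * (n + t)))%:R * p ^+ k.
Proof.
move=> p01; have /andP[p0 p1] := p01.
apply: le_trans (lerD (lerD (prob_few_edges n k p01) (prob_many_triangles n t p01))
  (lexx _)).
pose A := [set G : sgraph 'I_n | reconstructable (\pi_(ugraph n) G) &
  (#|triangles G| <= t)%N]%SET.
apply: (@le_trans _ _ (\sum_(G : sgraph 'I_n | (#|edges G| < k)%N) gnp p G +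
  \sum_(G : sgraph 'I_n | (t < #|triangles G|)%N) gnp p G + \sum_(G in A) p ^+ k)).
  rewrite ugnp_probE big_mkcond (big_mkcond (fun G : sgraph 'I_n => #|edges G| < k)%N).
  rewrite (big_mkcond (fun G : sgraph 'I_n => t < #|triangles G|)%N).
  rewrite (big_mkcond (fun G : sgraph 'I_n => G \in A)) -!big_split.
  apply: ler_sum => G _ /=; have g0 := gnp_ge0 G p01; have pk0 := exprn_ge0 k p0.
  have ge0 (b : bool) (x : R) : 0 <= x -> 0 <= (if b then x else 0) by case: b.
  case: ifPn => rG; last by rewrite !addr_ge0 ?ge0.
  case: ltnP => [_|kG]; first by rewrite -addrA lerDl addr_ge0 ?ge0.
  rewrite add0r; case: ltnP => [_|tG]; first by rewrite lerDl ge0.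
  by rewrite add0r inE rG tG gnp_le.
rewrite lerD2l sumr_const -[leLHS]mulr_natl ler_wpM2r ?exprn_ge0 //.
by rewrite ler_nat card_reconstructable.
Qed.

(** With [k] about [n ^ 2 * p / 32], the thresholds are [2 * k] edges and [k %/ 4] triangles. *)
Lemma prob_reconstructable_bound (R : realType) (n : nat) (p : R) :
  0 <= p <= 1 -> (1 < n)%N -> 640 <= n%:R * p -> n.+1%:R * p ^+ 2 <= 1 ->
  ugnp_prob p (@reconstructable n) <= n.+1%:R^-1 + n.+1%:R^-1 + 128 * (n%:R * p ^+ 2).
Proof.
move=> p01 n1 np p2; have /andP[p0 p1] := p01.
have n0 : 2 <= n%:R :> R by rewrite (ler_nat _ 2).
pose mu : R := n%:R * (n%:R * p).
have mun : 640 * n%:R <= mu by rewrite mulrC ler_wpM2l.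
have mu0 : 0 <= mu / 32 by rewrite divr_ge0 ?mulr_ge0.
pose k := Num.truncn (mu / 32).
have /andP[kle kgt] : k%:R <= mu / 32 < k.+1%:R by exact: truncn_itv.
(* Here [640 = 32 * 20] is used. *)
have kn : (20 * n < k.+1)%N by rewrite -(ltr_nat R) natrM; lra.
apply: le_trans (prob_reconstructable_le _ (2 * k) (k %/ 4) p01) _.
rewrite addrAC; apply: lerD.
  apply: lerD.
    have bin : n%:R * n%:R / 4 <= 'C(n, 2)%:R :> R.
      have : (n * n <= 4 * 'C(n, 2))%N by rewrite bin2; clear -n1; nia.
      by rewrite -(ler_nat R) !natrM; lra.
    (* The exponent is at most [mu / 16 - mu / 8 = - mu / 16 <= - 40 * n]. *)
    apply: (@le_trans _ _ (expR (- n%:R))).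
      rewrite ler_expR natrM.
      have : n%:R * n%:R / 4 * p <= 'C(n, 2)%:R * p by rewrite ler_wpM2r.
      have -> : n%:R * n%:R / 4 * p = mu / 4 by rewrite /mu; field.
      lra.
    rewrite expRN lef_pV2 ?posrE ?expR_gt0 ?ltr0n //.
    by rewrite -natr1 addrC expR_ge1Dx.
  (* The even exponent [2 * k] lets [p ^+ 2 <= n.+1%:R^-1] be raised to the power [k]. *)
  rewrite natrX (exprM p).
  have np0 : 0 < n.+1%:R :> R by rewrite ltr0n.
  apply: (@le_trans _ _ (n.+1%:R ^+ (3 * (n + k %/ 4)) / n.+1%:R ^+ k)).
    have p2V : p ^+ 2 <= n.+1%:R^-1 by rewrite -[leRHS]mul1r ler_pdivlMr // mulrC.
    rewrite -exprVn; apply: ler_wpM2l; first by rewrite exprn_ge0 ?ltW.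
    by apply: lerXn2r; rewrite ?nnegrE ?exprn_ge0 ?invr_ge0.
  rewrite ler_pdivrMr ?exprn_gt0 // ler_pdivlMl // -exprS.
  (* [3 * (n + k %/ 4) + 1 <= k] because [20 * n <= k]. *)
  by rewrite ler_weXn2l ?ler1n //; clear -kn n1; clearbody k; lia.
rewrite ler_pdivrMr ?ltr0n //.
have kt : mu / 32 <= 4 * (k %/ 4).+1%:R.
  by apply: (le_trans (ltW kgt)); rewrite -(natrM R 4) ler_nat; clear; lia.
have -> : (n%:R * p) ^+ 3 = 128 * (n%:R * p ^+ 2) * (mu / 32 / 4).
  by rewrite /mu; field.
by rewrite ler_wpM2l ?mulr_ge0 ?exprn_ge0 //; lra.
Qed.

(** * Passage to the limit *)

Local Open Scope classical_set_scope.

Theorem theorem1p1 (R : realType) (p : R^nat)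
    (p01 : forall n : nat, (0 < n)%N -> 0 <= p n <= 1)
    (p_lower : little_omega p (fun n : nat => n%:R^-1 * ln n%:R))
    (p_upper : (p : nat -> R^o) =o_\oo (fun n : nat => n%:R `^ (- 2^-1) : R^o)) :
  ugnp_prob (p n) (fun U : ugraph n => ~~ reconstructable U) @[n --> \oo] --> (1 : R).
Proof.
have np2 : n%:R * p n ^+ 2 @[n --> \oo] --> (0 : R).
  apply/cvgrPdist_le => eps eps0.
  (* The bound on [p n] will be squared, hence the square root. *)
  have e0 : 0 < Num.sqrt eps by rewrite sqrtr_gt0.
  move/eqoP: p_upper => /(_ _ e0) pe; near=> n.
  have np : (0 < n)%N by near: n; exact: nbhs_infty_gt.
  have n0 : 0 < n%:R :> R by rewrite ltr0n.
  have pn0 : 0 <= p n by have /andP[] := p01 n np.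
  rewrite sub0r normrN ger0_norm ?mulr_ge0 ?sqr_ge0 //.
  rewrite -ler_pdivlMl // mulrC.
  have -> : eps / n%:R = (Num.sqrt eps * `|n%:R `^ (- 2^-1)|) ^+ 2.
    rewrite exprMn sqr_sqrtr ?ltW // ger0_norm ?powR_ge0 // -powR_mulrn ?powR_ge0 //.
    by rewrite -powRrM mulNr mulVf ?pnatr_eq0 // powR_inv1 // ltW.
  apply: lerXn2r; rewrite ?nnegrE ?mulr_ge0 ?sqrtr_ge0 //.
  by rewrite -[leLHS]ger0_norm //; near: n.
have npy : n%:R * p n @[n --> \oo] --> +oo.
  (* The maximum with [0] ensures that multiplying the bound by [ln n >= 1] does not decrease it. *)
  apply/cvgryPge => A; have [p0 /cvgryPge/(_ (Num.max A 0)) pA] := p_lower.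
  near=> m.
  have n0 : 0 < m%:R :> R by rewrite ltr0n; near: m; exact: nbhs_infty_gt.
  have ln1 : 1 <= ln m%:R :> R.
    rewrite -ler_expR lnK ?posrE //.
    near: m; exact: nbhs_infty_ger.
  have : Num.max A 0 <= p m / (m%:R^-1 * ln m%:R) by near: m.
  rewrite invfM invrK mulrCA mulrA [X in X / _]mulrC ler_pdivlMr ?(lt_le_trans ltr01) // => H.
  rewrite mulrC; apply: le_trans H; apply: (@le_trans _ _ (Num.max A 0)).
    by rewrite le_max lexx.
  by rewrite ler_peMr // le_max lexx orbT.
(* Since [n.+1 <= 2 * n], the constant [2^-1] yields [n.+1%:R * p n ^+ 2 <= 1]. *)
have half : \forall n \near \oo, n%:R * p n ^+ 2 <= 2^-1.
  by apply: (@cvgr_le _ _ _ _ _ _ np2); rewrite invr_gt0.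
suff rec0 : ugnp_prob (p n) (@reconstructable n) @[n --> \oo] --> (0 : R).
  under eq_fun do rewrite ugnp_probC.
  by have := cvgB (cvg_cst (1 : R)) rec0; rewrite subr0; apply.
apply: (@squeeze_cvgr _ _ _ _ (fun=> 0)
  (fun n => n.+1%:R^-1 + n.+1%:R^-1 + 128 * (n%:R * p n ^+ 2))).
- near=> n; have n1 : (1 < n)%N by near: n; exact: nbhs_infty_gt.
  have pn01 : 0 <= p n <= 1 by apply: p01; lia.
  rewrite ugnp_prob_ge0 //= prob_reconstructable_bound //.
    by near: n; move/cvgryPge: npy; apply.
  have : n%:R * p n ^+ 2 <= 2^-1.
    by near: n; exact: half.
  have : n.+1%:R * p n ^+ 2 <= 2 * n%:R * p n ^+ 2.
    by rewrite ler_wpM2r ?sqr_ge0 // -(natrM R 2) ler_nat; lia.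
  lra.
- exact: cvg_cst.
- have harm := @cvg_harmonic R.
  have := cvgD (cvgD harm harm) (cvgM (cvg_cst (128 : R)) np2).
  by rewrite mulr0 !addr0; apply.
Unshelve. all: by end_near.
Qed.
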